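(* For every countable group $G$, $SR(\mathbb{C}G)=RR(\mathbb{C}G)$.
   Context: Let $A$ be a unital $\mathbb{C}$-algebra. For a finite-dimensional subspace $L\subseteq A$ with $1\in L$ and $\varepsilon>0$, an $\varepsilon$-almost representation of $L$ is a linear map $\psi:L\to\operatorname{End}_{\mathbb{C}}(V)$, $V$ finite-dimensional, with $\psi(1)=\mathrm{Id}$, such that there is a subspace $V_\varepsilon\subseteq V$ with $\dim V-\dim V_\varepsilon<\varepsilon\dim V$ and $\psi(a)\psi(b)v=\psi(ab)v$ for all $a,b\in L$ with $ab\in L$ and all $v\in V_\varepsilon$. $A$ has almost finite dimensional representations if every such $L$ has an $\varepsilon$-almost representation for every $\varepsilon>0$. Rank radical $RR(A)$: if $A$ lacks almost finite dimensional representations, $RR(A)=A$; otherwise $p\in RR(A)$ iff there exists a finite-dimensional subspace $L$ with $\{1,p\}\subseteq L\subseteq A$ such that for every $\delta>0$ there is $\eta>0$ such that for every $0<\varepsilon<\eta$ and every $\varepsilon$-almost representation $\psi:L\to\operatorname{End}(V)$, $\dim\operatorname{Ran}\psi(p)<\delta\dim V$. Sofic radical $SR(A)$: if $A$ lacks almost finite dimensional representations, $SR(A)=A$; otherwise $p\in SR(A)$ iff for every $\delta>0$ there exist a finite-dimensional subspace $L$ with $\{1,p\}\subseteq L\subseteq A$ and $\eta>0$ such that for every $0<\varepsilon<\eta$ and every $\varepsilon$-almost representation $\psi:L\to\operatorname{End}(V)$, $\dim\operatorname{Ran}\psi(p)<\delta\dim V$. *)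

(* Defs.v *)
From Stdlib Require Import Reals List Classical ClassicalEpsilon ClassicalDescription.
Open Scope R_scope.

Record C : Type := mkC { re : R; im : R }.
Definition C0 : C := mkC 0 0.
Definition C1 : C := mkC 1 0.
Definition Cadd (x y : C) : C := mkC (re x + re y) (im x + im y).
Definition Copp (x : C) : C := mkC (- re x) (- im x).
Definition Cmul (x y : C) : C :=
  mkC (re x * re y - im x * im y) (re x * im y + im x * re y).

Fixpoint Csum (n : nat) (f : nat -> C) : C :=
  match n with O => C0 | S k => Cadd (Csum k f) (f k) end.

(** * Linear algebra on V = C^n.  Vectors are [nat -> C], matrices
    [nat -> nat -> C]; only indices < n are meaningful. *)
Definition vec := nat -> C.
Definition mat := nat -> nat -> C.

Definition veq (n : nat) (v w : vec) : Prop := forall i, (i < n)%nat -> v i = w i.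
Definition meq (n : nat) (M N : mat) : Prop :=
  forall i j, (i < n)%nat -> (j < n)%nat -> M i j = N i j.

Definition mv (n : nat) (M : mat) (v : vec) : vec :=
  fun i => Csum n (fun j => Cmul (M i j) (v j)).
Definition madd (M N : mat) : mat := fun i j => Cadd (M i j) (N i j).
Definition mscale (a : C) (M : mat) : mat := fun i j => Cmul a (M i j).
Definition mid : mat := fun i j => if Nat.eqb i j then C1 else C0.
Definition vzero : vec := fun _ => C0.

Definition vcomb (k : nat) (c : nat -> C) (w : nat -> vec) : vec :=
  fun t => Csum k (fun i => Cmul (c i) (w i t)).

Definition lin_indep (n k : nat) (w : nat -> vec) : Prop :=
  forall c : nat -> C, veq n (vcomb k c w) vzero -> forall i, (i < k)%nat -> c i = C0.

Definition in_span (n k : nat) (w : nat -> vec) (v : vec) : Prop :=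
  exists c : nat -> C, veq n v (vcomb k c w).

Definition dim_range (n : nat) (M : mat) (d : nat) : Prop :=
  exists w : nat -> vec,
    lin_indep n d w /\
    (forall i, (i < d)%nat -> exists x, veq n (w i) (mv n M x)) /\
    (forall x, in_span n d w (mv n M x)).

Definition rank_lt (n : nat) (M : mat) (delta : R) : Prop :=
  exists d, dim_range n M d /\ INR d < delta * INR n.

Record IsGroup (G : Type) (mul : G -> G -> G) (inv : G -> G) (e : G) : Prop := {
  grp_assoc : forall x y z, mul x (mul y z) = mul (mul x y) z;
  grp_idl : forall x, mul e x = x;
  grp_invl : forall x, mul (inv x) x = e
}.

Definition countable (G : Type) : Prop :=
  exists f : G -> nat, forall x y, f x = f y -> x = y.

(** * The group algebra C[G], as formal finite sums modulo equality of
    coefficients. An element is a list of (coefficient, group element). *)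
Section GroupAlgebra.
Variables (G : Type) (mul : G -> G -> G) (e : G).

Definition FS := list (C * G).

Definition coef (x : FS) (g : G) : C :=
  fold_right (fun cg acc =>
      if excluded_middle_informative (snd cg = g) then Cadd (fst cg) acc else acc)
    C0 x.

Definition fs_eq (x y : FS) : Prop := forall g, coef x g = coef y g.

Definition fs_add (x y : FS) : FS := x ++ y.
Definition fs_scale (a : C) (x : FS) : FS := map (fun cg => (Cmul a (fst cg), snd cg)) x.
Definition fs_one : FS := (C1, e) :: nil.
Definition fs_mul (x y : FS) : FS :=
  flat_map (fun cg => map (fun dh => (Cmul (fst cg) (fst dh), mul (snd cg) (snd dh))) y) x.

Fixpoint fs_comb (B : list FS) (c : nat -> C) : FS :=
  match B with
  | nil => nil
  | b :: B' => fs_add (fs_scale (c O) b) (fs_comb B' (fun i => c (S i)))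
  end.

(** A finite-dimensional subspace L of C[G] is given as the span of a finite list B. *)
Definition inL (B : list FS) (x : FS) : Prop := exists c, fs_eq x (fs_comb B c).

Definition almost_rep (B : list FS) (eps : R) (n : nat) (psi : FS -> mat) : Prop :=
  (forall x y, inL B x -> inL B y -> fs_eq x y -> meq n (psi x) (psi y)) /\
  (forall x y a, inL B x -> inL B y ->
      meq n (psi (fs_add x (fs_scale a y))) (madd (psi x) (mscale a (psi y)))) /\
  meq n (psi fs_one) mid /\
  exists (d : nat) (w : nat -> vec),
    lin_indep n d w /\
    INR n - INR d < eps * INR n /\
    (forall a b v, inL B a -> inL B b -> inL B (fs_mul a b) -> in_span n d w v ->
       veq n (mv n (psi a) (mv n (psi b) v)) (mv n (psi (fs_mul a b)) v)).

Definition has_afdr : Prop :=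
  forall B : list FS, inL B fs_one ->
  forall eps, 0 < eps -> exists (n : nat) (psi : FS -> mat), almost_rep B eps n psi.

Definition in_RR (p : FS) : Prop :=
  ~ has_afdr \/
  (has_afdr /\
   exists B : list FS, inL B fs_one /\ inL B p /\
     forall delta, 0 < delta -> exists eta, 0 < eta /\
       forall eps, 0 < eps -> eps < eta ->
       forall (n : nat) (psi : FS -> mat), almost_rep B eps n psi ->
         rank_lt n (psi p) delta).

Definition in_SR (p : FS) : Prop :=
  ~ has_afdr \/
  (has_afdr /\
   forall delta, 0 < delta ->
   exists B : list FS, inL B fs_one /\ inL B p /\
     exists eta, 0 < eta /\
       forall eps, 0 < eps -> eps < eta ->
       forall (n : nat) (psi : FS -> mat), almost_rep B eps n psi ->
         rank_lt n (psi p) delta).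

End GroupAlgebra.

(* Main.v *)
(** Call two elements [g], [h] of [G] indistinguishable if [rho g - rho h] has small
    normalized rank in every sufficiently good almost representation [rho] on one
    fixed finite set.  Replace each group element in [p] by a representative of its
    class.  If the result is zero, then [p] lies in the rank radical.  Otherwise some
    [h0] keeps a nonzero coefficient and is distinguishable from every other [h]
    in the support.

    Amplification: from [rho] with [rho h0 - rho h] of relative rank bounded below,
    however small the bound, the tensor powers of [1 + rho] have, for
    [A = rho(h0) rho(h)^-1], a subspace [S] of relative dimension at least 1/4 with
    [S] and [A S] independent.  Compressing by suitable [Q], [P] kills [rho h] and leaves
    [rho h0] invertible of relative rank 1/4.  The tensor product of these representations
    over all [h] kills every term of [p] but the one at [h0], so the rank of [p] is
    bounded below by a constant depending only on the size of its support, and [p] is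
    not in the sofic radical. *)
From Stdlib Require Import Reals List Classical ClassicalEpsilon ClassicalDescription Lra.
From Stdlib Require Import FunctionalExtensionality PropExtensionality.
From mathcomp Require Import all_boot all_order all_algebra.
From mathcomp Require Import mxtens zify complex Rstruct.
Require Import Defs.
Set Implicit Arguments.
Unset Strict Implicit.
Unset Printing Implicit Defensive.
Import GRing.Theory.
Local Open Scope ring_scope.

(** * Tensor products and separated subspaces *)

Section Tensor.
Variable K : fieldType.

Lemma tensmx11 m n : (1%:M : 'M[K]_m) *t (1%:M : 'M[K]_n) = 1%:M.
Proof.
apply/matrixP => i j.
case: (mxtens_indexP i) => i0 i1; case: (mxtens_indexP j) => j0 j1.
rewrite tensmxE !mxE -natrM mulnb.
by rewrite (can_eq (@mxtens_indexK _ _)).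
Qed.

Lemma tensmx_unitmx m n (A : 'M[K]_m) (B : 'M[K]_n) :
  A \in unitmx -> B \in unitmx -> A *t B \in unitmx.
Proof.
move=> uA uB; suff: (invmx A *t invmx B) *m (A *t B) = 1%:M by case/mulmx1_unit.
by rewrite tensmx_mul !mulVmx // tensmx11.
Qed.

Lemma invmx_tens m n (A : 'M[K]_m) (B : 'M[K]_n) :
  A \in unitmx -> B \in unitmx -> invmx (A *t B) = invmx A *t invmx B.
Proof.
move=> uA uB; have uAB := tensmx_unitmx uA uB.
by rewrite -[RHS](mulmxK uAB) tensmx_mul !mulVmx // tensmx11 mul1mx.
Qed.

Lemma tensmxBl m n p q (A B : 'M[K]_(m, n)) (D : 'M[K]_(p, q)) :
  (A - B) *t D = A *t D - B *t D.
Proof. by apply/matrixP => i j; rewrite !mxE mulrBl. Qed.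

Lemma tensmxBr m n p q (A B : 'M[K]_(m, n)) (D : 'M[K]_(p, q)) :
  D *t (A - B) = D *t A - D *t B.
Proof. by apply/matrixP => i j; rewrite !mxE mulrBr. Qed.

Lemma mxrank_tensl m n (A : 'M[K]_m) (B : 'M[K]_n) :
  (\rank (A *t B) <= \rank A * n)%N.
Proof.
rewrite -{1}(mulmx_base A) -[B]mul1mx -tensmx_mul.
exact: mulmx_max_rank.
Qed.

Lemma mxrank_tensr m n (A : 'M[K]_m) (B : 'M[K]_n) :
  (\rank (A *t B) <= m * \rank B)%N.
Proof.
rewrite -{1}(mulmx_base B) -[A]mul1mx -tensmx_mul.
exact: mulmx_max_rank.
Qed.

End Tensor.

Section Separation.
Variable K : fieldType.

(* [sep M s]: the row space of [Q] is an s-dimensional subspace S with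
   [S M] disjoint from [S] and [M] injective on [S]. *)
Definition sep n (M : 'M[K]_n) (s : nat) :=
  exists (Q : 'M[K]_(s, n)) (P : 'M[K]_(n, s)),
    Q *m P = 0 /\ Q *m M *m P \in unitmx.

Lemma sep0 n (M : 'M[K]_n) : sep M 0.
Proof. by exists 0, 0; rewrite !mul0mx unitmxE det_mx00 unitr1. Qed.

(* In suitable coordinates [A] is block triangular with diagonal blocks [T], separated
   in half its dimension [2 t], and the scalar [a]. *)
Definition split_form n (A : 'M[K]_n) :=
  exists t m (q0 : 'M[K]_(t, n)) (p0 : 'M[K]_(n, t))
    (q1 : 'M[K]_(m, n)) (p1 : 'M[K]_(n, m)) (a : K),
  [/\ [/\ q0 *m p0 = 0, q0 *m p1 = 0, q1 *m p0 = 0 & q1 *m p1 = 1%:M],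
      q0 *m A *m p0 \in unitmx, q0 *m A *m p1 = 0, q1 *m A *m p1 = a%:M &
      [/\ a != 0, (2 * t + m = n)%N & (\rank (A - a%:M)%R <= 2 * t)%N]].

Lemma block_lower_unitmx m n (A : 'M[K]_m) (B : 'M[K]_(n, m)) (D : 'M[K]_n) :
  (block_mx A 0 B D \in unitmx) = (A \in unitmx) && (D \in unitmx).
Proof. by rewrite !unitmxE det_lblock unitrM. Qed.

Lemma sep_tens n w (A : 'M[K]_n) (E : 'M[K]_w) r :
  split_form A -> E \in unitmx -> sep E r ->
  exists t m a, [/\ (2 * t + m = n)%N, (\rank (A - a%:M)%R <= 2 * t)%N &
    sep (A *t E) (t * w + m * r)].
Proof.
move=> [t [m [q0 [p0 [q1 [p1 [a]]]]]]].
case=> [[z00 z01 z10 z11] u0 A01 A11 [a0 tm rA]] uE [Q [P [QP uQ]]].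
exists t, m, a; split => //.
exists (col_mx (q0 *t 1%:M) (q1 *t Q)), (row_mx (p0 *t 1%:M) (p1 *t P)); split.
  by rewrite mul_col_row !tensmx_mul z00 z01 z10 QP !tens0mx tensmx0 block_mx0.
rewrite mul_col_mx mul_col_row !tensmx_mul A01 A11 tens0mx block_lower_unitmx.
rewrite mul1mx mulmx1 !tensmx_unitmx //.
by rewrite unitmxE det_scalar unitfE expf_neq0.
Qed.

Lemma row_free_col_mx n (x y : 'rV[K]_n) :
  y != 0 -> ~~ (x <= y)%MS -> row_free (col_mx x y).
Proof.
move=> y0 xy; rewrite -kermx_eq0; apply/rowV0P => v /sub_kermxP.
rewrite -[v]hsubmxK mul_row_col (mx11_scalar (lsubmx v)) (mx11_scalar (rsubmx v)).
rewrite !mul_scalar_mx; set c := _ 0 0; set d := rsubmx v 0 0 => cd.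
have c0 : c = 0.
  apply: contraNeq xy => c0.
  have -> : x = (- (c^-1 * d)) *: y.
    apply: (scalerI c0); rewrite scalerA mulrN mulrA divff // mul1r scaleNr.
    by apply/eqP; rewrite -addr_eq0 cd.
  by rewrite scalemx_sub.
move/eqP: cd; rewrite c0 scale0r add0r scaler_eq0 (negPf y0) orbF => /eqP ->.
by rewrite !raddf0 row_mx0.
Qed.

End Separation.

Lemma mxrank_row_mx (K : fieldType) m n p (A : 'M[K]_(m, n)) (B : 'M[K]_(m, p)) :
  (\rank (row_mx A B) <= \rank A + \rank B)%N.
Proof.
rewrite -mxrank_tr tr_row_mx -addsmxE -(mxrank_tr A) -(mxrank_tr B).
exact: mxrank_adds_leqif.
Qed.

(** * Triangular splitting over an algebraically closed field *)

Section ClosedField.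
Variable K : closedFieldType.

Lemma eigenvector_exists n (A : 'M[K]_n) : (0 < n)%N ->
  exists a (u : 'rV[K]_n), u *m A = a *: u /\ u != 0.
Proof.
move=> n0; have /closed_rootP[a ra] : size (char_poly A) != 1%N.
  by rewrite size_char_poly; case: (n) n0.
have /eigenvalueP[u uA u0] : eigenvalue A a by rewrite eigenvalue_root_char.
by exists a, u.
Qed.

(* [x] is killed by [(A - mu)(A - nu)] but is not an eigenvector. *)
Lemma nonscalar_plane n (A : 'M[K]_n) : (0 < n)%N -> (forall a, A != a%:M) ->
  exists mu nu (x y : 'rV[K]_n),
    [/\ x *m A = mu *: x + y, y *m A = nu *: y & row_free (col_mx x y)].
Proof.
move=> n0 nsA; have [mu [u [uA u0]]] := eigenvector_exists A n0.
pose M := A - mu%:M.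
have MA v : v *m A = mu *: v + v *m M.
  by rewrite mulmxBr mul_mx_scalar addrC subrK.
have M0 : M != 0 by rewrite subr_eq0.
have r0 : (0 < \rank M)%N by rewrite lt0n mxrank_eq0.
(* [A] commutes with [M], hence preserves its row space; [B] is the action there. An eigenvector of
   [B] gives an eigenvector [y = x *m M] of [A]. *)
pose B := row_base M *m A *m pinvmx (row_base M).
have BR : B *m row_base M = row_base M *m A.
  rewrite mulmxKpV // (eqmxMr _ (eq_row_base _)) eq_row_base.
  have -> : M *m A = A *m M by rewrite mulmxBl mulmxBr scalar_mxC.
  exact: submxMl.
have [nu [z [zB z0]]] := eigenvector_exists B r0.
pose y := z *m row_base M.
have yA : y *m A = nu *: y by rewrite -mulmxA -BR mulmxA zB scalemxAl.
have y0 : y != 0.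
  apply: contraNneq z0 => y0; apply/eqP/(row_free_inj (row_base_free M)).
  by rewrite mul0mx.
have /submxP[x yx] : (y <= M)%MS by rewrite -(eq_row_base M) submxMl.
have uM : u *m M = 0 by rewrite mulmxBr uA mul_mx_scalar subrr.
exists mu, nu; have [xy|xy] := boolP (x <= y)%MS; last first.
  exists x, y; split=> //; first by rewrite MA -yx.
  exact: row_free_col_mx.
(* Adding [u] leaves [x *m M = y] unchanged. If [x] and [x + u] were both multiples of [y], so would
   be [u]; then [y *m M = 0] and [y = x *m M] would vanish. *)
exists (x + u), y; split=> //; first by rewrite MA mulmxDl uM addr0 -yx.
apply: row_free_col_mx => //; apply: contra_neqN y0 => xuy.
have /sub_rVP[c uc] : (u <= y)%MS.
  by rewrite -[u](addKr x) addmx_sub // eqmx_opp.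
have c0 : c != 0 by apply: contraNneq u0 => c0; rewrite uc c0 scale0r.
have yM : y *m M = 0.
  have : c *: (y *m M) = 0 by rewrite scalemxAl -uc uM.
  by move/eqP; rewrite scaler_eq0 (negPf c0) => /eqP.
have /sub_rVP[d xd] := xy.
by rewrite yx xd -scalemxAl yM scaler0.
Qed.

Lemma complete_basis k n (B : 'M[K]_(k, n)) : row_free B ->
  exists m (R : 'M[K]_(m, n)) (V : 'M[K]_(n, k + m)),
    [/\ (k + m = n)%N, col_mx B R *m V = 1%:M & V *m col_mx B R = 1%:M].
Proof.
move=> fB; have rB : \rank B = k by apply/eqP.
exists _, (row_base B^C%MS), (pinvmx (col_mx B (row_base B^C%MS))).
have kn : (k + \rank B^C%MS = n)%N.
  by rewrite mxrank_compl rB subnKC // -rB rank_leq_col.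
have full : row_full (col_mx B (row_base B^C%MS)).
  rewrite -sub1mx -addsmxE.
  by rewrite (adds_eqmx (eqmx_refl B) (eq_row_base _)) sub1mx addsmx_compl_full.
split=> //; last exact: mulVpmx.
by apply: mulmxVp; rewrite /row_free (eqP full) kn.
Qed.

(** Induction on the dimension. A scalar matrix has [t = 0]; otherwise the invariant plane of
    [nonscalar_plane] is split off, adding 1 to [t], and the induction hypothesis applies to the
    action on the quotient. *)
Lemma split_form_exists n (A : 'M[K]_n) : A \in unitmx -> split_form A.
Proof.
have [k] := ubnP n; elim: k n A => // k IH n A nk uA.
have [n0|n0] := posnP n.
  subst n; exists 0%N, 0%N, 0, 0, 0, 0, 1; split.
  - by split; apply/matrixP => -[].
  - by rewrite unitmxE det_mx00 unitr1.
  - by apply/matrixP => -[].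
  - by apply/matrixP => -[].
  - by rewrite oner_eq0; split=> //; rewrite muln0 rank_leq_row.
have [/is_scalar_mxP[a Aa]|nsA] := boolP (is_scalar_mx A).
  have a0 : a != 0.
    apply: contraTneq uA => a0; rewrite Aa a0 unitmxE det_scalar expr0n.
    by rewrite eqn0Ngt n0 unitr0.
  exists 0%N, n, 0, 0, 1%:M, 1%:M, a; split.
  - by split; rewrite ?mul0mx ?mulmx0 ?mulmx1.
  - by rewrite unitmxE det_mx00 unitr1.
  - by rewrite !mul0mx.
  - by rewrite mul1mx mulmx1.
  - by split=> //; rewrite Aa subrr mxrank0.
have {}nsA a : A != a%:M by apply: contraNneq nsA => ->; exact: scalar_mx_is_scalar.
have [mu [nu [x [y [xA yA fxy]]]]] := nonscalar_plane n0 nsA.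
have [m [R [V [kn UV VU]]]] := complete_basis fxy.
set U := col_mx _ R in UV VU.
pose D : 'M[K]_(1 + 1) := block_mx mu%:M 1%:M 0 nu%:M.
have DE : col_mx x y *m A = D *m col_mx x y.
  by rewrite mul_col_mx mul_block_col xA yA !mul_scalar_mx scale1r mul0mx add0r.
pose S := dsubmx (U *m A *m V).
have UAV : U *m A *m V = block_mx D 0 (lsubmx S) (rsubmx S).
  rewrite -[LHS]vsubmxK -/S block_mxEv hsubmxK; congr col_mx.
  rewrite -!mul_usub_mx col_mxKu DE -mulmxA.
  have -> : col_mx x y = row_mx 1%:M 0 *m U by rewrite mul_row_col mul1mx mul0mx addr0.
  by rewrite -mulmxA UV mulmx1 mul_mx_row mulmx1 mulmx0.
have uUAV : U *m A *m V \in unitmx.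
  have : (U *m A *m V) *m (U *m invmx A *m V) = 1%:M.
    by rewrite !mulmxA -(mulmxA _ V U) VU mulmx1 (mulmxK uA).
  by case/mulmx1_unit.
have uA' : rsubmx S \in unitmx.
  by move: uUAV; rewrite UAV block_lower_unitmx => /andP[].
have mk : (m < k)%N by rewrite -kn in nk; lia.
have [t [m' [q0 [p0 [q1 [p1 [a]]]]]]] := IH _ _ mk uA'.
case=> [[z00 z01 z10 z11] u0 A01 A11 [a0 tm rA']].
(* [q] selects [x] and [p] reads the coordinate along [y], so [q *m D *m p] is the coefficient 1 of
   [y] in [x *m A]. *)
pose q : 'rV[K]_(1 + 1) := row_mx 1%:M 0.
pose p : 'cV[K]_(1 + 1) := col_mx 0 1%:M.
have qp : q *m p = 0 by rewrite mul_row_col mulmx0 mul0mx addr0.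
have qDp : q *m D *m p = 1%:M.
  rewrite mul_row_block mul_row_col !mul1mx !mul0mx !addr0.
  by rewrite mulmx0 mulmx1 add0r.
pose Q0 := block_mx q 0 0 q0; pose P0 := block_mx p 0 0 p0.
pose Q1 : 'M[K]_(m', 1 + 1 + m) := row_mx 0 q1.
pose P1 : 'M[K]_(1 + 1 + m, m') := col_mx 0 p1.
have conj r s (X : 'M[K]_(r, 1 + 1 + m)) (Y : 'M[K]_(1 + 1 + m, s)) :
    X *m U *m (V *m Y) = X *m Y.
  by rewrite mulmxA -(mulmxA X) UV mulmx1.
have conjA r s (X : 'M[K]_(r, 1 + 1 + m)) (Y : 'M[K]_(1 + 1 + m, s)) :
    X *m U *m A *m (V *m Y) = X *m block_mx D 0 (lsubmx S) (rsubmx S) *m Y.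
  by rewrite -UAV !mulmxA.
exists (1 + t)%N, m', (Q0 *m U), (V *m P0), (Q1 *m U), (V *m P1), a.
rewrite !conj !conjA; split.
- split.
  + by rewrite mulmx_block qp z00 !mulmx0 !mul0mx !addr0 block_mx0.
  + by rewrite mul_block_col z01 !mulmx0 !mul0mx !addr0 col_mx0.
  + by rewrite mul_row_block z10 !mulmx0 !mul0mx !addr0 row_mx0.
  + by rewrite mul_row_col z11 mulmx0 add0r.
- rewrite !mulmx_block !(mulmx0, mul0mx, addr0, add0r) block_lower_unitmx.
  by rewrite qDp unitmx1.
- rewrite mulmx_block mul_block_col !(mulmx0, mul0mx, addr0, add0r).
  by rewrite A01 col_mx0.
- by rewrite mul_row_block mul_row_col !(mulmx0, mul0mx, add0r) A11.
split=> //; first by rewrite -kn -tm; lia.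
have -> : A - a%:M = V *m (U *m A *m V - a%:M) *m U.
  rewrite mulmxBr mulmxBl !mulmxA VU mul1mx -(mulmxA _ V U) VU mulmx1.
  by rewrite mul_mx_scalar -scalemxAl VU scalemx1.
apply: leq_trans (mxrankM_maxl _ _) _; apply: leq_trans (mxrankM_maxr _ _) _.
rewrite UAV (scalar_mx_block (1 + 1) m a) opp_block_mx add_block_mx !oppr0 !addr0.
rewrite block_mxEh; apply: leq_trans (mxrank_row_mx _ _) _.
rewrite mulnDr; apply: leq_add; first exact: rank_leq_col.
by rewrite rank_col_0mx.
Qed.
End ClosedField.

(** * Group-level almost representations and amplification *)

Section NearRepresentations.
Variables (K : closedFieldType) (G : Type) (mul : G -> G -> G) (e : G).

(* The normalized rank defect of multiplicativity on [F] is at most [1/k];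
   reciprocals of natural numbers replace the real parameters epsilon and delta. *)
Record near_rep (F : list G) (k n : nat) (rho : G -> 'M[K]_n) : Prop := NearRep {
  near_rep_unit : forall g, rho g \in unitmx;
  near_rep1 : rho e = 1%:M;
  near_repM : forall g h, In g F -> In h F ->
    (k * \rank (rho g *m rho h - rho (mul g h))%R <= n)%N }.

(** [F] is chosen before [k], as [L] precedes [delta] in the rank radical. Failure thus gives, for
    each [F], one [k] violated by arbitrarily good near representations. *)
Definition indist (g h : G) :=
  exists F, forall k, exists k', forall n (rho : G -> 'M[K]_n),
    near_rep F k' rho -> (k * \rank (rho g - rho h)%R <= n)%N.

Lemma near_rep_weaken F F' k k' n (rho : G -> 'M[K]_n) :
  incl F F' -> (k <= k')%N -> near_rep F' k' rho -> near_rep F k rho.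
Proof.
move=> FF' kk' [u o m]; split=> // g h Fg Fh.
by apply: leq_trans (m g h (FF' _ Fg) (FF' _ Fh)); rewrite leq_mul2r kk' orbT.
Qed.

Lemma indist_refl g : indist g g.
Proof. by exists nil => k; exists 0%N => n rho _; rewrite subrr mxrank0 muln0. Qed.

Lemma indist_sym g h : indist g h -> indist h g.
Proof.
move=> [F H]; exists F => k; have [k' H'] := H k; exists k' => n rho /H'.
by rewrite -mxrank_opp opprB.
Qed.

Lemma indist_trans h g l : indist g h -> indist h l -> indist g l.
Proof.
move=> [F1 H1] [F2 H2]; exists (F1 ++ F2) => k.
have [k1 {}H1] := H1 (2 * k)%N; have [k2 {}H2] := H2 (2 * k)%N.
exists (maxn k1 k2) => n rho nr.
have /H1 h1 : near_rep F1 k1 rho.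
  by apply: near_rep_weaken nr; [apply: incl_appl; apply: incl_refl | exact: leq_maxl].
have /H2 h2 : near_rep F2 k2 rho.
  by apply: near_rep_weaken nr; [apply: incl_appr; apply: incl_refl | exact: leq_maxr].
have : (\rank (rho g - rho l)%R <= \rank (rho g - rho h)%R + \rank (rho h - rho l)%R)%N.
  by rewrite -[X in (\rank X <= _)%N](subrKA (rho h)) mxrank_add.
move: h1 h2; move: (\rank _) (\rank _) (\rank _); nia.
Qed.

Lemma near_rep_trivial F k : near_rep F k (fun _ => 1%:M : 'M[K]_1).
Proof.
split=> [g||g h _ _] //; first exact: unitmx1.
by rewrite mulmx1 subrr mxrank0 muln0.
Qed.

(** The defect telescopes into [X *t (theta g *m theta h)] and [rho (mul g h) *t Y], each of
    relative rank at most [1/(2k)]. *)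
Lemma near_rep_tens F k m n (rho : G -> 'M[K]_m) (theta : G -> 'M[K]_n) :
  near_rep F (2 * k) rho -> near_rep F (2 * k) theta ->
  near_rep F k (fun g => rho g *t theta g).
Proof.
move=> [u1 o1 m1] [u2 o2 m2]; split=> [g||g h Fg Fh].
- exact: tensmx_unitmx.
- by rewrite o1 o2 tensmx11.
rewrite tensmx_mul -(subrKA (rho (mul g h) *t (theta g *m theta h))).
rewrite -tensmxBl -tensmxBr.
have := m1 g h Fg Fh; have := m2 g h Fg Fh.
set X := rho g *m _ - _; set Y := theta g *m _ - _.
have := mxrank_add (X *t (theta g *m theta h)) (rho (mul g h) *t Y).
have := mxrank_tensl X (theta g *m theta h).
have := mxrank_tensr (rho (mul g h)) Y.
move: (\rank _) (\rank _) (\rank _) (\rank _) (\rank _); nia.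
Qed.

(** The trivial block serves to keep the quotient of two values far from every scalar other than
    1. *)
Lemma near_rep_add1 F k n (rho : G -> 'M[K]_n) :
  near_rep F k rho -> near_rep F k (fun g => block_mx (1%:M : 'M[K]_n) 0 0 (rho g)).
Proof.
move=> [u o m]; split=> [g||g h Fg Fh].
- by rewrite block_lower_unitmx unitmx1 u.
- by rewrite o -scalar_mx_block.
rewrite mulmx_block !(mulmx0, mul0mx, addr0, add0r, mulmx1).
rewrite opp_block_mx add_block_mx !oppr0 !addr0 subrr rank_diag_block_mx mxrank0.
by apply: leq_trans (m g h Fg Fh) _; apply: leq_addr.
Qed.

(** Each round tensors with [rho], and [sep_tens] raises the density [r/N] by [(t/n)(1 - 2r/N)].
    Farness from scalars forces [t/n >= 1/(2D)], so below density 1/4 a round gains at least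
    [1/(4D)]. Each round also halves the precision, hence [2 ^ k]. *)
Lemma amplify F n (rho : G -> 'M[K]_n) h0 h D k c :
  (0 < n)%N ->
  (forall a, n <= D * \rank (rho h0 *m invmx (rho h) - a%:M)%R)%N ->
  near_rep F (c * 2 ^ k) rho ->
  exists N (theta : G -> 'M[K]_N) r,
    [/\ (0 < N)%N, near_rep F c theta, sep (theta h0 *m invmx (theta h)) r &
        (N <= 4 * r)%N \/ (k * N <= 4 * D * r)%N].
Proof.
move=> n0 far; elim: k c => [|k IH] c nr.
  exists 1%N, (fun=> 1%:M), 0%N; split=> //; last by right.
  - exact: near_rep_trivial.
  - exact: sep0.
have pow : (c * 2 ^ k.+1 = 2 * c * 2 ^ k)%N by rewrite expnS; lia.
have [|N [theta [r [N0 nrt st rN]]]] := IH (2 * c)%N; first by rewrite -pow.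
have nr2 : near_rep F (2 * c) rho.
  apply: near_rep_weaken nr; first exact: incl_refl.
  by rewrite pow leq_pmulr // expn_gt0.
have [[u1 _ _] [u2 _ _]] := (nr2, nrt).
have uA : rho h0 *m invmx (rho h) \in unitmx by rewrite unitmx_mul unitmx_inv !u1.
have uE : theta h0 *m invmx (theta h) \in unitmx by rewrite unitmx_mul unitmx_inv !u2.
have [t [m [a [tm rA s]]]] := sep_tens (split_form_exists uA) uE st.
exists (n * N)%N, (fun g => rho g *t theta g), (t * N + m * r)%N; split.
- by rewrite muln_gt0 n0.
- exact: near_rep_tens.
- by rewrite invmx_tens // tensmx_mul.
have nD : (n <= D * (2 * t))%N by apply: leq_trans (far a) _; rewrite leq_mul2l rA orbT.
(* Density 1/4 persists: [4(tN + mr) >= (4t + m)N] and [4t + m >= n]. *)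
have [Nr|rN'] := leqP N (4 * r)%N.
  by left; clear - Nr tm; subst n; nia.
case: rN => [|rN]; first by rewrite leqNgt rN'.
right.
have e1 : (4 * D * (t * N + m * r) = 2 * (D * (2 * t)) * N + m * (4 * D * r))%N by lia.
have e2 : (k.+1 * (n * N) = n * N + 2 * t * (k * N) + m * (k * N))%N.
  by rewrite -tm; lia.
have e3 : (n * N <= D * (2 * t) * N)%N by rewrite leq_mul2r nD orbT.
have e4 : (2 * t * (k * N) <= 2 * t * (4 * D * r))%N by rewrite leq_mul2l rN orbT.
have e5 : (2 * t * (4 * D * r) <= 2 * t * D * N)%N.
  have -> : (2 * t * (4 * D * r) = 2 * t * D * (4 * r))%N by lia.
  by rewrite leq_mul2l (ltnW rN') orbT.
have e6 : (m * (k * N) <= m * (4 * D * r))%N by rewrite leq_mul2l rN orbT.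
lia.
Qed.

(** Running [amplify] for [2k] rounds with [D = 2k] makes both of its outcomes density 1/4, however
    large the [k] given by distinguishability. *)
Lemma separate_pair h0 h F c : ~ indist h h0 ->
  exists N (theta : G -> 'M[K]_N) s (Q : 'M[K]_(s, N)) (P : 'M[K]_(N, s)),
    [/\ (0 < N)%N, near_rep F c theta, (N <= 4 * s)%N,
        Q *m theta h *m P = 0 & Q *m theta h0 *m P \in unitmx].
Proof.
move=> nind; have [k Hk] := not_all_ex_not _ _ (not_ex_all_not _ _ nind F).
have {Hk} Hk k' : exists n (rho : G -> 'M[K]_n),
    near_rep F k' rho /\ (n < k * \rank (rho h - rho h0)%R)%N.
  apply: NNPP => H; apply: Hk; exists k' => n rho nr.
  by rewrite leqNgt; apply/negP => lt; apply: H; exists n, rho.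
have [n [rho [nr far]]] := Hk (c * 2 ^ (2 * k))%N.
have k0 : (0 < k)%N by case: (k) far.
have n0 : (0 < n)%N.
  rewrite lt0n; apply: contraTneq far => n0; rewrite -leqNgt.
  have : (\rank (rho h - rho h0)%R <= n)%N by exact: rank_leq_row.
  by move: (\rank _) => r; rewrite n0 leqn0 => /eqP ->; rewrite muln0.
have [u _ _] := nr.
have nr1 := near_rep_add1 nr; have [u1 _ _] := nr1.
set rho1 := fun g => _ in nr1 u1.
have inv1 : invmx (rho1 h) = block_mx 1%:M 0 0 (invmx (rho h)).
  rewrite -[RHS](mulmxK (u1 h)) /rho1 mulmx_block !(mulmx0, mul0mx, addr0, add0r, mulmx1).
  by rewrite mulVmx // -scalar_mx_block mul1mx.
(* For [a = 1] the rank is that of [rho h - rho h0]; for other [a] the trivial block alone has rank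
   [n]. The factor 2 on [k] absorbs the doubled dimension. *)
have far1 a : (n + n <= (2 * k) * \rank (rho1 h0 *m invmx (rho1 h) - a%:M)%R)%N.
  rewrite inv1 /rho1 mulmx_block !(mulmx0, mul0mx, addr0, add0r, mulmx1).
  rewrite (scalar_mx_block n n a) opp_block_mx add_block_mx !oppr0 !addr0.
  rewrite rank_diag_block_mx; have [->|a1] := eqVneq a 1.
    have -> : \rank (rho h0 *m invmx (rho h) - 1%:M) = \rank (rho h - rho h0).
      rewrite -(mulmxV (u h)) -mulmxBl mxrankMfree ?row_free_unit ?unitmx_inv //.
      by rewrite -mxrank_opp opprB.
    by move: far; clear; rewrite mulnDr; lia.
  have -> : \rank (1%:M - a%:M : 'M[K]_n) = n.
    rewrite -raddfB mxrank_unit // unitmxE det_scalar unitfE expf_neq0 //.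
    by rewrite subr_eq0 eq_sym.
  clear - k0; nia.
have [|N [theta [s [N0 nrt [Q [P [QP uQ]]] sN]]]] := amplify _ far1 nr1.
  by rewrite addn_gt0 n0.
have [ut _ _] := nrt.
(* Absorbing the inverse into [P] turns [Q *m P = 0] into the vanishing of the compressed
   [theta h]. *)
exists N, theta, s, Q, (invmx (theta h) *m P); split=> //.
- by case: sN => // sN; clear - sN k0; nia.
- by rewrite mulmxA mulmxK.
- by move: uQ; rewrite !mulmxA.
Qed.

(** A compressed tensor product vanishes once one factor does, while at [h0] all factors are
    invertible. Each [h] costs a factor 4, independently of [F] and [c]. *)
Lemma separate_list h0 hs F c : (forall h, In h hs -> ~ indist h h0) ->
  exists N (theta : G -> 'M[K]_N) s (Q : 'M[K]_(s, N)) (P : 'M[K]_(N, s)),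
    [/\ (0 < N)%N, near_rep F c theta, (N <= 4 ^ length hs * s)%N,
        forall h, In h hs -> Q *m theta h *m P = 0 & Q *m theta h0 *m P \in unitmx].
Proof.
elim: hs c => [|h hs IH] c nind.
  exists 1%N, (fun=> 1%:M), 1%N, 1%:M, 1%:M; split=> //; first exact: near_rep_trivial.
  by rewrite !mulmx1 unitmx1.
have [h' hs_h'|N1 [th1 [s1 [Q1 [P1 [N10 nr1 le1 z1 u1]]]]]] := IH (2 * c)%N.
  by apply: nind; right.
have [|N2 [th2 [s2 [Q2 [P2 [N20 nr2 le2 z2 u2]]]]]] :=
  @separate_pair h0 h F (2 * c)%N; first by apply: nind; left.
exists (N1 * N2)%N, (fun g => th1 g *t th2 g), (s1 * s2)%N, (Q1 *t Q2), (P1 *t P2).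
split.
- by rewrite muln_gt0 N10.
- exact: near_rep_tens.
- by have := leq_mul le1 le2; rewrite /= expnS; set x := (4 ^ _)%N; lia.
- move=> h' [<-|hs_h']; rewrite !tensmx_mul; first by rewrite z2 tensmx0.
  by rewrite z1 // tens0mx.
- by rewrite !tensmx_mul tensmx_unitmx.
Qed.

End NearRepresentations.

(** * Coordinates and formal sums *)

Notation CC := (complex Rdefinitions.R).

Definition toCC (z : Defs.C) : CC := Complex (re z) (im z).
Definition ofCC (z : CC) : Defs.C := let: Complex a b := z in mkC a b.

Lemma toCCK : cancel toCC ofCC. Proof. by case. Qed.
Lemma ofCCK : cancel ofCC toCC. Proof. by case. Qed.
Lemma toCC_inj : injective toCC. Proof. exact: can_inj toCCK. Qed.
Lemma toCC0 : toCC C0 = 0. Proof. by []. Qed.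
Lemma toCC1 : toCC C1 = 1. Proof. by []. Qed.
Lemma toCCD x y : toCC (Cadd x y) = toCC x + toCC y. Proof. by []. Qed.
Lemma toCCM x y : toCC (Cmul x y) = toCC x * toCC y. Proof. by []. Qed.

Lemma toCC_Csum n f : toCC (Csum n f) = \sum_(i < n) toCC (f i).
Proof. by elim: n => [|n IH]; rewrite ?big_ord0 // big_ord_recr /= -IH. Qed.

Section Matrices.

Definition tomx m n (M : nat -> nat -> Defs.C) : 'M[CC]_(m, n) :=
  \matrix_(i, j) toCC (M i j).
Definition torv n (v : vec) : 'rV[CC]_n := \row_i toCC (v i).
Definition ofmx m n (X : 'M[CC]_(m, n)) : nat -> nat -> Defs.C := fun i j =>
  if insub i is Some i' then
    if insub j is Some j' then ofCC (X i' j') else C0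
  else C0.

Lemma ofmxK m n (X : 'M[CC]_(m, n)) : tomx m n (ofmx X) = X.
Proof. by apply/matrixP => i j; rewrite mxE /ofmx !valK ofCCK. Qed.

Lemma ofrvK n (x : 'rV[CC]_n) : torv n (ofmx x 0%N) = x.
Proof.
apply/rowP => j; rewrite mxE /ofmx; case: insubP => // i _ i0.
by rewrite valK ofCCK ord1.
Qed.

Lemma meqP n M N : meq n M N <-> tomx n n M = tomx n n N.
Proof.
split=> [H|/matrixP H i j /ssrnat.ltP hi /ssrnat.ltP hj].
  by apply/matrixP => i j; rewrite !mxE H //; apply/ssrnat.ltP.
by have := H (Ordinal hi) (Ordinal hj); rewrite !mxE => /toCC_inj.
Qed.

Lemma veqP n v w : veq n v w <-> torv n v = torv n w.
Proof.
split=> [H|/rowP H i /ssrnat.ltP hi].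
  by apply/rowP => i; rewrite !mxE H //; apply/ssrnat.ltP.
by have := H (Ordinal hi); rewrite !mxE => /toCC_inj.
Qed.

(** Column vectors become rows, so the range of [M] is the row space of its transpose. *)
Lemma torv_mv n M v : torv n (mv n M v) = torv n v *m (tomx n n M)^T.
Proof.
apply/rowP => i; rewrite !mxE toCC_Csum; apply: eq_bigr => j _.
by rewrite !mxE toCCM mulrC.
Qed.

Lemma torv_vcomb n k c w : torv n (vcomb k c w) = torv k c *m tomx k n w.
Proof.
apply/rowP => i; rewrite !mxE toCC_Csum; apply: eq_bigr => j _.
by rewrite !mxE toCCM.
Qed.

Lemma tomx_madd n M N : tomx n n (madd M N) = tomx n n M + tomx n n N.
Proof. by apply/matrixP => i j; rewrite !mxE. Qed.

Lemma tomx_mscale n a M : tomx n n (mscale a M) = toCC a *: tomx n n M.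
Proof. by apply/matrixP => i j; rewrite !mxE. Qed.

Lemma tomx_mid n : tomx n n mid = 1%:M.
Proof.
apply/matrixP => i j; rewrite !mxE /mid.
case: Nat.eqb_spec => [/val_inj ->|ij]; first by rewrite eqxx.
by case: eqP => // ij'; case: ij; rewrite ij'.
Qed.

Lemma torv_vzero n : torv n vzero = 0.
Proof. by apply/rowP => i; rewrite !mxE. Qed.

Lemma lin_indepP n k w : lin_indep n k w <-> row_free (tomx k n w).
Proof.
split=> [H|fw c /veqP].
  rewrite -kermx_eq0; apply/rowV0P => v /sub_kermxP vw.
  have /H c0 : veq n (vcomb k (ofmx v 0%N) w) vzero.
    by apply/veqP; rewrite torv_vcomb ofrvK vw torv_vzero.
  rewrite -[v]ofrvK; apply/rowP => i; rewrite !mxE c0 //; exact/ssrnat.ltP.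
rewrite torv_vcomb torv_vzero => cw i /ssrnat.ltP hi.
have /rowP/(_ (Ordinal hi)) : torv k c = 0 by apply: (row_free_inj fw); rewrite cw mul0mx.
by rewrite !mxE => ci; apply: toCC_inj; rewrite ci.
Qed.

Lemma in_spanP n k w v : in_span n k w v <-> (torv n v <= tomx k n w)%MS.
Proof.
split=> [[c /veqP ->]|/submxP[x vx]]; first by rewrite torv_vcomb submxMl.
by exists (ofmx x 0%N); apply/veqP; rewrite torv_vcomb ofrvK.
Qed.

Lemma dim_range_rank n M : dim_range n M (\rank (tomx n n M)^T).
Proof.
set X := (tomx n n M)^T; exists (ofmx (row_base X)); split; last split.
- by apply/lin_indepP; rewrite ofmxK row_base_free.
- move=> i /ssrnat.ltP hi.
  have /submxP[x rx] : (row (Ordinal hi) (row_base X) <= X)%MS.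
    by rewrite (submx_trans (row_sub _ _)) // eq_row_base.
  exists (ofmx x 0%N); apply/veqP; rewrite torv_mv ofrvK -rx.
  by apply/rowP => j; rewrite -[in RHS](ofmxK (row_base X)) !mxE.
- by move=> x; apply/in_spanP; rewrite ofmxK eq_row_base torv_mv submxMl.
Qed.

Lemma rank_dim_range n M d : dim_range n M d -> (\rank (tomx n n M) <= d)%N.
Proof.
move=> [w [_ [_ H]]]; rewrite -mxrank_tr.
apply: leq_trans (rank_leq_row (tomx d n w)); apply: mxrankS.
apply/row_subP => i; rewrite rowE -[delta_mx _ _]ofrvK -torv_mv.
exact/in_spanP.
Qed.

End Matrices.

(** * Formal sums and their linear extensions *)

Section FormalSums.
Variables (G : Type) (mul : G -> G -> G) (e : G).
Implicit Types (V : lmodType CC) (x y : FS G).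

Definition supp x : list G := List.map snd x.

(** The linear extension of [f] to the group algebra. Taking indicator functions recovers the
    coefficients, so these extensions detect equality of formal sums. *)
Definition lin V (f : G -> V) x : V := \sum_(cg <- x) toCC cg.1 *: f cg.2.

Lemma lin_nil V (f : G -> V) : lin f nil = 0.
Proof. exact: big_nil. Qed.

Lemma lin_cons V (f : G -> V) cg x : lin f (cg :: x) = toCC cg.1 *: f cg.2 + lin f x.
Proof. exact: big_cons. Qed.

Lemma lin_add V (f : G -> V) x y : lin f (fs_add G x y) = lin f x + lin f y.
Proof. by rewrite /lin -big_cat. Qed.

Lemma lin_scale V (f : G -> V) a x : lin f (fs_scale G a x) = toCC a *: lin f x.
Proof.
elim: x => [|cg x IH]; first by rewrite lin_nil scaler0.
by rewrite !lin_cons scalerDr -IH /= scalerA.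
Qed.

Lemma lin_mul V (f : G -> V) x y :
  lin f (fs_mul G mul x y) = lin (fun g => lin (fun h => f (mul g h)) y) x.
Proof.
elim: x => [|cg x IH]; first by rewrite !lin_nil.
rewrite lin_cons -IH -[fs_mul _ _ _ _]/(fs_add G _ _) lin_add; congr (_ + _).
elim: y {IH} => [|dh y IH] /=; first by rewrite !lin_nil scaler0.
by rewrite !lin_cons IH scalerDr scalerA.
Qed.

Lemma eq_lin V (f f' : G -> V) x :
  (forall g, In g (supp x) -> f g = f' g) -> lin f x = lin f' x.
Proof.
elim: x => [|cg x IH] ff'; first by rewrite !lin_nil.
by rewrite !lin_cons IH => [|g xg]; rewrite ?ff' //; [left | right].
Qed.

Definition remove g x : FS G :=
  List.filter (fun cg => if excluded_middle_informative (snd cg = g) then false else true) x.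

Lemma lin_remove V (f : G -> V) g x :
  lin f x = toCC (coef G x g) *: f g + lin f (remove g x).
Proof.
elim: x => [|cg x IH]; first by rewrite !lin_nil addr0 scale0r.
rewrite lin_cons IH /=; case: excluded_middle_informative => [cgg|ncg] /=.
  by rewrite cgg toCCD scalerDl addrA.
by rewrite lin_cons addrCA.
Qed.

Lemma coef_remove g x h : coef G (remove g x) h = coef G x h \/ coef G (remove g x) h = C0.
Proof.
have [->|hg] := classic (h = g); [right | left].
  elim: x => [|cg x IH] //=; case: excluded_middle_informative => //= ncg.
  by case: excluded_middle_informative.
elim: x => [|cg x IH] //=; case: excluded_middle_informative => [cgg|ncg] /=.
  by rewrite IH; case: excluded_middle_informative => // cgh; case: hg; rewrite -cgg -cgh.
by rewrite IH.
Qed.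

Lemma In_supp_remove g x h : In h (supp (remove g x)) -> In h (supp x) /\ h <> g.
Proof.
move=> /in_map_iff[cg [<- /filter_In[xcg]]].
case: excluded_middle_informative => // ncg _; split=> //.
exact: in_map.
Qed.

(** Induction on length: [remove] deletes all terms at the head's group element, which sum to zero,
    and the other coefficients stay zero. *)
Lemma lin_eq0 V (f : G -> V) x : (forall g, coef G x g = C0) -> lin f x = 0.
Proof.
have [k] := ubnP (length x); elim: k x => // k IH [|[c g] x] xk x0.
  exact: lin_nil.
rewrite (lin_remove _ g) x0 scale0r add0r IH //; last first.
  by move=> h; case: (coef_remove g ((c, g) :: x) h) => ->.
rewrite /=; case: excluded_middle_informative => //= _.
apply: leq_trans (xk : (length x < k)%N); rewrite ltnS.
by apply/ssrnat.leP; apply: filter_length_le.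
Qed.

Lemma coef_lin g x :
  toCC (coef G x g) =
  lin (fun h => if excluded_middle_informative (h = g) then 1 else 0 : CC^o) x.
Proof.
elim: x => [|cg x IH]; first by rewrite lin_nil.
rewrite lin_cons -IH /=; case: excluded_middle_informative => [cgg|ncg] /=.
  by rewrite toCCD [_ *: _]mulr1.
by rewrite scaler0 add0r.
Qed.

Lemma fs_eqP x y : fs_eq G x y <-> (forall V (f : G -> V), lin f x = lin f y).
Proof.
split=> [xy V f|xy g]; last by apply: toCC_inj; rewrite !coef_lin xy.
apply/eqP; rewrite -subr_eq0; apply/eqP.
have := @lin_eq0 V f (fs_add G x (fs_scale G (ofCC (- 1)) y)).
rewrite lin_add lin_scale ofCCK scaleN1r; apply => g.
apply: toCC_inj; rewrite coef_lin lin_add lin_scale ofCCK scaleN1r -!coef_lin xy.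
by rewrite subrr.
Qed.

Lemma lin_fs_comb V (f : G -> V) B c :
  lin f (fs_comb G B c) = \sum_(i < length B) toCC (c i) *: lin f (List.nth i B nil).
Proof.
elim: B c => [|b B IH] c; first by rewrite big_ord0 lin_nil.
by rewrite big_ord_recl /= lin_add lin_scale IH.
Qed.

Lemma inL_fs_eq B x y : fs_eq G x y -> inL G B x -> inL G B y.
Proof. by move=> xy [c xc]; exists c => g; rewrite -xy. Qed.

Lemma inL_add B x y : inL G B x -> inL G B y -> inL G B (fs_add G x y).
Proof.
move=> [c /fs_eqP xc] [d /fs_eqP yd]; exists (fun i => Cadd (c i) (d i)).
apply/fs_eqP => V f; rewrite lin_add xc yd !lin_fs_comb -big_split.
by apply: eq_bigr => i _; rewrite toCCD scalerDl.
Qed.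

Lemma inL_scale B a x : inL G B x -> inL G B (fs_scale G a x).
Proof.
move=> [c /fs_eqP xc]; exists (fun i => Cmul a (c i)).
apply/fs_eqP => V f; rewrite lin_scale xc !lin_fs_comb scaler_sumr.
by apply: eq_bigr => i _; rewrite scalerA toCCM.
Qed.

Lemma inL_nil B : inL G B nil.
Proof.
exists (fun _ => C0); apply/fs_eqP => V f; rewrite lin_nil lin_fs_comb big1 // => i _.
exact: scale0r.
Qed.

Lemma inL_In B b : In b B -> inL G B b.
Proof.
move=> /(@In_nth _ _ _ nil)[i [/ssrnat.ltP iB bi]].
exists (fun j => if Nat.eqb j i then C1 else C0).
apply/fs_eqP => V f; rewrite lin_fs_comb (bigD1 (Ordinal iB)) //= Nat.eqb_refl bi.
rewrite scale1r big1 ?addr0 // => j ji.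
case: Nat.eqb_spec => [jj|_]; last exact: scale0r.
by case/eqP: ji; apply: val_inj.
Qed.

Lemma supp_fs_comb B c : incl (supp (fs_comb G B c)) (flat_map supp B).
Proof.
elim: B c => [|b B IH] c g //=; rewrite /supp /fs_add map_app !in_app_iff.
case=> [|/IH]; last by right.
by rewrite /fs_scale map_map /=; left.
Qed.

Definition single g : FS G := (C1, g) :: nil.

Lemma lin_single V (f : G -> V) g : lin f (single g) = f g.
Proof. by rewrite lin_cons lin_nil addr0 scale1r. Qed.

Lemma inL_supp F x : incl (supp x) F -> inL G (List.map single F) x.
Proof.
elim: x => [|[c g] x IH] xF; first exact: inL_nil.
apply: (@inL_fs_eq _ (fs_add G (fs_scale G c (single g)) x)).
  by apply/fs_eqP => V f; rewrite lin_add lin_scale lin_single lin_cons.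
apply: inL_add; last by apply: IH => h xh; apply: xF; right.
by apply: inL_scale; apply: inL_In; apply: in_map; apply: xF; left.
Qed.

Lemma mxrank_lin n (f : G -> 'M[CC]_n) k m x :
  (forall g, In g (supp x) -> (k * \rank (f g) <= m)%N) ->
  (k * \rank (lin f x) <= length x * m)%N.
Proof.
elim: x => [|cg x IH] fx; first by rewrite lin_nil mxrank0 muln0.
rewrite lin_cons /=.
have h1 : (k * \rank (f cg.2) <= m)%N by apply: fx; left.
have h2 : (k * \rank (lin f x) <= length x * m)%N by apply: IH => g xg; apply: fx; right.
have := mxrank_add (toCC cg.1 *: f cg.2) (lin f x).
have := mxrank_scale (toCC cg.1) (f cg.2).
move: h1 h2; move: (\rank _) (\rank _) (\rank _) (\rank _) (length x); nia.
Qed.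

End FormalSums.

(** * Almost representations of subspaces *)

Section RealBounds.
Local Open Scope R_scope.

Lemma INR_leq (m n : nat) : INR m <= INR n -> (m <= n)%N.
Proof. by move=> /INR_le /ssrnat.leP. Qed.

Lemma leq_INR (m n : nat) : (m <= n)%N -> INR m <= INR n.
Proof. by move=> /ssrnat.leP /le_INR. Qed.

Lemma INRM (m n : nat) : INR (m * n)%N = INR m * INR n.
Proof. exact: mult_INR. Qed.

Lemma INRB (m n : nat) : (n <= m)%N -> INR (m - n)%N = INR m - INR n.
Proof. by move=> /ssrnat.leP; exact: minus_INR. Qed.

Lemma defect_leq n d k eps :
  INR n - INR d < eps * INR n -> eps * INR k <= 1 -> (k * (n - d) <= n)%N.
Proof.
move=> nd ek; have [nled|dn] := leqP n d.
  by move: nled; rewrite -subn_eq0 => /eqP ->; rewrite muln0.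
apply: INR_leq; rewrite INRM INRB ?(ltnW dn) //.
have := pos_INR k; have := pos_INR n; nra.
Qed.

Lemma leq_frac n r k m eps :
  (0 < n)%N -> (k * r <= m * n)%N -> INR m < eps * INR k -> INR r < eps * INR n.
Proof.
move=> n0 kr mk.
have := leq_INR kr; rewrite !INRM => kr'.
have n1 := leq_INR n0; rewrite /= in n1.
have := pos_INR m; have := pos_INR k => k0 m0.
have k1 : 0 < INR k by case: k0 => // k0; rewrite -k0 in mk; lra.
have : INR m * INR n < eps * INR k * INR n by apply: Rmult_lt_compat_r; lra.
move=> h; apply: (Rmult_lt_reg_l (INR k)) => //; lra.
Qed.

Lemma leq_defect n r k m eps :
  (0 < n)%N -> (r <= n)%N -> (k * r <= m * n)%N -> INR m < eps * INR k ->
  INR n - INR (n - r) < eps * INR n.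
Proof.
move=> n0 rn kr mk; rewrite INRB //.
have := leq_frac n0 kr mk; lra.
Qed.

Lemma INR_archimedean x (eps : R) : 0 < eps -> exists k, x < eps * INR k.
Proof. by move=> e0; have [k] := INR_archimed eps x e0; exists k; lra. Qed.

End RealBounds.

Section Bridges.
Variables (G : Type) (mul : G -> G -> G) (inv : G -> G) (e : G).

Lemma lin_mulmx n (f f' : G -> 'M[CC]_n) x y :
  lin f x *m lin f' y = lin (fun g => lin (fun h => f g *m f' h) y) x.
Proof.
rewrite /lin mulmx_suml; apply: eq_bigr => cg _.
rewrite mulmx_sumr scaler_sumr; apply: eq_bigr => dh _.
by rewrite -scalemxAl -scalemxAr.
Qed.

Lemma mulmx_tr_lin n (v : 'rV[CC]_n) (f : G -> 'M[CC]_n) x :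
  v *m (lin f x)^T = lin (fun g => v *m (f g)^T) x.
Proof.
rewrite /lin raddf_sum mulmx_sumr; apply: eq_bigr => cg _.
by rewrite scalemxAr; congr (_ *m _); apply/matrixP => i j; rewrite !mxE.
Qed.

(** One good subspace must serve all products at once. With [Z] the sum of the row spaces, a row
    killed by [Z^T] is killed by the transpose of every listed [X g h]. *)
Lemma common_cover n (X : G -> G -> 'M[CC]_n) k (l : list (G * G)) :
  (forall g h, In (g, h) l -> (k * \rank (X g h) <= n)%N) ->
  exists Z : 'M[CC]_n, (k * \rank Z <= length l * n)%N /\
    forall g h, In (g, h) l -> (X g h <= Z)%MS.
Proof.
elim: l => [|[g h] l IH] Xl; first by exists 0; rewrite mxrank0 muln0.
have [g' h' gh'|Z [rZ XZ]] := IH; first by apply: Xl; right.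
exists (X g h + Z)%MS; split; last first.
  move=> g' h' [[<- <-]|gh']; first exact: addsmxSl.
  by apply: submx_trans (XZ _ _ gh') (addsmxSr _ _).
have Xgh : (k * \rank (X g h) <= n)%N by apply: Xl; left.
have rXZ : (\rank (X g h + Z)%MS <= \rank (X g h) + \rank Z)%N.
  exact: mxrank_adds_leqif.
apply: (leq_trans (n := k * (\rank (X g h) + \rank Z)%N)); first by rewrite leq_mul2l rXZ orbT.
by rewrite mulnDr /= mulSn leq_add.
Qed.

Lemma inL_fs_comb B x : inL G B x -> exists x',
  (forall (V : lmodType CC) (f : G -> V), lin f x = lin f x') /\
  incl (supp x') (flat_map (@supp G) B).
Proof.
by move=> [c xc]; exists (fs_comb G B c); split; [apply/fs_eqP | apply: supp_fs_comb].
Qed.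

(** [rho] is extended linearly; the good subspace is the kernel of [Z^T], where [Z] covers the
    defects of all pairs from [F], so its codimension is at most [|F|^2 n/k]. *)
Lemma near_rep_almost_rep B F k n (rho : G -> 'M[CC]_n) eps :
  (0 < n)%N -> incl (flat_map (@supp G) B) F -> near_rep mul e F k rho ->
  Rlt (INR (length F * length F)) (Rmult eps (INR k)) ->
  almost_rep G mul e B eps n (fun x => ofmx (lin rho x)).
Proof.
move=> n0 BF [_ rho1 rhoM] ek; split; last split; last split.
- by move=> x y _ _ /fs_eqP xy; apply/meqP; rewrite xy.
- move=> x y a _ _; apply/meqP.
  by rewrite tomx_madd tomx_mscale !ofmxK lin_add lin_scale.
- by apply/meqP; rewrite ofmxK tomx_mid -rho1 -[fs_one _ _]/(single e) lin_single.
pose X g h := rho g *m rho h - rho (mul g h).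
have [g h /in_prod_iff[Fg Fh]|Z [rZ XZ]] := @common_cover n X k (list_prod F F).
  exact: rhoM.
rewrite length_prod in rZ.
exists (n - \rank Z)%N, (ofmx (row_base (kermx Z^T))).
have -> : (n - \rank Z)%N = \rank (kermx Z^T) by rewrite mxrank_ker mxrank_tr.
split; last split.
- by apply/lin_indepP; rewrite ofmxK row_base_free.
- by rewrite mxrank_ker mxrank_tr; apply: (leq_defect n0 _ rZ ek); exact: rank_leq_row.
move=> a b v /inL_fs_comb[a' [aa' a'B]] /inL_fs_comb[b' [bb' b'B]] _ /in_spanP.
rewrite ofmxK eq_row_base => /sub_kermxP vZ.
apply/veqP; rewrite !torv_mv !ofmxK -mulmxA -trmx_mul lin_mul lin_mulmx !mulmx_tr_lin.
rewrite !aa'; apply: eq_lin => g /a'B/BF Fg.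
rewrite !mulmx_tr_lin !bb'; apply: eq_lin => h /b'B/BF Fh.
apply/eqP; rewrite -subr_eq0 -mulmxBr -raddfB.
have /submxP[Y XY] : (X g h <= Z)%MS by apply: XZ; apply/in_prod_iff.
by rewrite -/(X g h) XY /= trmx_mul mulmxA vZ mul0mx.
Qed.

(* The inverses are needed to bound the rank of [psi g] from below. *)
Definition nbhd (F : list G) : list G :=
  let F1 := F ++ List.map (fun gh => mul gh.1 gh.2) (list_prod F F) in
  e :: F1 ++ List.map inv F1.

Hypothesis HG : IsGroup G mul inv e.

Lemma nbhd_incl F : incl F (nbhd F).
Proof. by move=> g Fg; right; apply/in_app_iff; left; apply/in_app_iff; left. Qed.

(** On group elements [psi] is multiplicative up to rank [D = n - d], and replacing a matrix by an
    invertible one costs at most [D]. A product involves three replacements and one original defect,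
    whence the 4 in the bound on [eps]. *)
Lemma almost_rep_near_rep F k eps n psi :
  almost_rep G mul e (List.map (@single G) (nbhd F)) eps n psi ->
  Rle (Rmult eps (INR (4 * k))) R1 ->
  exists rho : G -> 'M[CC]_n, [/\ (0 < n)%N, near_rep mul e F k rho,
    forall g, In g F -> (k * \rank (rho g - tomx n n (psi (single g)))%R <= n)%N &
    forall x, incl (supp x) (nbhd F) ->
      tomx n n (psi x) = lin (fun g => tomx n n (psi (single g))) x].
Proof.
move=> [wd [psil [/meqP one [d [w [/lin_indepP fw [nd am]]]]]]] ek.
pose P g := tomx n n (psi (single g)).
have inLs g : In g (nbhd F) -> inL G (List.map (@single G) (nbhd F)) (single g).
  by move=> Fg; apply: inL_In; apply: in_map.
have dn : (d <= n)%N by move: fw => /eqP <-; exact: rank_leq_col.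
(* Dimension zero is excluded because the defect inequality is strict. *)
have n0 : (0 < n)%N.
  rewrite lt0n; apply/eqP => n0; move: nd dn; rewrite n0 /= => nd.
  by rewrite leqn0 => /eqP d0; move: nd; rewrite d0 /=; lra.
have D4 : (4 * k * (n - d) <= n)%N := defect_leq nd ek.
set D := (n - d)%N in D4.
have mulP g h : In g (nbhd F) -> In h (nbhd F) -> In (mul g h) (nbhd F) ->
    (\rank (P g *m P h - P (mul g h))%R <= D)%N.
  move=> Fg Fh Fgh; rewrite -mxrank_tr.
  have sM : fs_mul G mul (single g) (single h) = single (mul g h).
    by congr (_ :: nil); congr (_, _); apply: toCC_inj; rewrite toCCM toCC1 mul1r.
  have : tomx d n w *m (P g *m P h - P (mul g h))^T = 0.
    apply/row_matrixP => i; rewrite row0 row_mul.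
    have wi : torv n (w i) = row i (tomx d n w) by apply/rowP => j; rewrite !mxE.
    have := am (single g) (single h) (w i) (inLs _ Fg) (inLs _ Fh).
    rewrite sM => /(_ (inLs _ Fgh)) H.
    have /H/veqP : in_span n d w (w i) by apply/in_spanP; rewrite wi row_sub.
    rewrite !torv_mv wi raddfB mulmxBr /= trmx_mul mulmxA => ->.
    by rewrite subrr.
  by move=> /mulmx0_rank_max; rewrite /D leq_subRL // (eqP fw).
have Pe : P e = 1%:M by rewrite -tomx_mid -one.
(* The invertible matrix obtained from the factorization [P g = L *m pid_mx r *m U]
   by dropping the middle factor. *)
pose rho g := col_ebase (P g) *m row_ebase (P g).
have rhoP g : (\rank (rho g - P g)%R <= n - \rank (P g))%N.
  rewrite /rho -[X in _ - X]mulmx_ebase -mulmxBl -[X in X - _]mulmx1 -mulmxBr.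
  apply: leq_trans (mxrankM_maxl _ _) _; apply: leq_trans (mxrankM_maxr _ _) _.
  by rewrite -[1%:M - _]/(copid_mx _) rank_copid_mx // rank_leq_row.
have rhoe : rho e = 1%:M.
  rewrite -Pe; apply/eqP; rewrite -subr_eq0 -mxrank_eq0 -leqn0.
  by apply: leq_trans (rhoP e) _; rewrite Pe mxrank1 subnn.
(* [P (inv g) *m P g] is within rank [D] of the identity, so [P g] has rank at least [n - D]. *)
have Prank g : In g (nbhd F) -> In (inv g) (nbhd F) -> (n - \rank (P g) <= D)%N.
  move=> Fg Fig; have Fe : In (mul (inv g) g) (nbhd F) by rewrite (grp_invl _ _ _ _ HG); left.
  have := mulP _ _ Fig Fg Fe; rewrite (grp_invl _ _ _ _ HG) Pe => r1.
  have := mxrankM_maxr (P (inv g)) (P g).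
  have := mxrank_add (P (inv g) *m P g) (- (P (inv g) *m P g - 1%:M)).
  rewrite opprB addrCA subrr addr0 mxrank1 -(mxrank_opp (1%:M - _)) opprB => r2 r3.
  by move: r1 r2 r3; move: (\rank _) (\rank _) (\rank _); lia.
have FP g : In g F -> (\rank (rho g - P g)%R <= D)%N.
  move=> Fg; apply: leq_trans (rhoP g) _; apply: Prank; first exact: nbhd_incl.
  right; apply/in_app_iff; right; apply: in_map.
  by apply/in_app_iff; left.
have FFP g h : In g F -> In h F -> In (mul g h) (nbhd F) /\
    (\rank (rho (mul g h) - P (mul g h))%R <= D)%N.
  move=> Fg Fh.
  have Fgh : In (mul g h) (F ++ List.map (fun gh => mul gh.1 gh.2) (list_prod F F)).
    apply/in_app_iff; right; apply/in_map_iff.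
    by exists (g, h); split=> //; apply/in_prod_iff.
  have nFgh : In (mul g h) (nbhd F) by right; apply/in_app_iff; left.
  split=> //; apply: leq_trans (rhoP _) _; apply: Prank => //.
  by right; apply/in_app_iff; right; apply: in_map.
exists rho; split=> //.
- split=> // [g|g h Fg Fh].
    by rewrite unitmx_mul col_ebase_unit row_ebase_unit.
  have [nFgh rgh] := FFP g h Fg Fh.
  have := mulP _ _ (nbhd_incl Fg) (nbhd_incl Fh) nFgh.
  have -> : rho g *m rho h - rho (mul g h) = (rho g - P g) *m rho h +
    P g *m (rho h - P h) + (P g *m P h - P (mul g h)) - (rho (mul g h) - P (mul g h)).
    rewrite mulmxBl mulmxBr; move: (rho g *m rho h) (P g *m rho h) (P g *m P h) => a b c.
    by rewrite opprB !addrA !subrK.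
  have := mxrank_add ((rho g - P g) *m rho h + P g *m (rho h - P h) +
    (P g *m P h - P (mul g h))) (- (rho (mul g h) - P (mul g h))).
  have := mxrank_add ((rho g - P g) *m rho h + P g *m (rho h - P h))
    (P g *m P h - P (mul g h)).
  have := mxrank_add ((rho g - P g) *m rho h) (P g *m (rho h - P h)).
  have := mxrankM_maxl (rho g - P g) (rho h).
  have := mxrankM_maxr (P g) (rho h - P h).
  rewrite mxrank_opp; have := FP g Fg; have := FP h Fh; move: rgh.
  move: (\rank _) (\rank _) (\rank _) (\rank _) (\rank _) (\rank _) (\rank _)
    (\rank _) (\rank _); clear - D4; nia.
- move=> g Fg; apply: leq_trans D4; rewrite leq_mul //; last exact: FP.
  by rewrite leq_pmull.
elim=> [|[c g] x IH] xF.
  (* Additivity gives [psi nil = psi nil + psi nil], so [psi nil] vanishes. *)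
  have nl := @inL_nil G (List.map (@single G) (nbhd F)).
  have /meqP := psil nil nil C1 nl nl.
  rewrite tomx_madd tomx_mscale toCC1 scale1r lin_nil /=.
  by move/eqP; rewrite eq_sym -subr_eq0 addrK => /eqP.
have xF' : incl (supp x) (nbhd F) by move=> h xh; apply: xF; right.
have gF : In g (nbhd F) by apply: xF; left.
rewrite lin_cons -IH //= addrC.
have Lx := inL_supp xF'; have Lg := inLs _ gF.
have /meqP := psil _ _ c Lx Lg; rewrite tomx_madd tomx_mscale => <-.
apply/meqP; apply: wd; first exact: inL_supp.
  by apply: inL_add => //; apply: inL_scale.
by apply/fs_eqP => V f; rewrite lin_add lin_scale lin_single lin_cons addrC.
Qed.

End Bridges.

(** * Class representatives and the comparison of the two radicals *)

Section Representatives.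
Variables (G : Type) (mul : G -> G -> G) (e : G).
Local Notation indist := (@indist CC G mul e).

Definition rep (g : G) : G := ClassicalEpsilon.epsilon (inhabits e) (indist^~ g).

Lemma rep_indist g : indist (rep g) g.
Proof.
apply: (ClassicalEpsilon.epsilon_spec (inhabits e) (indist^~ g)).
by exists g; apply: indist_refl.
Qed.

(** Indistinguishable elements define the same predicate by extensionality, so [epsilon] makes the
    same choice. *)
Lemma rep_eq g h : indist g h -> rep g = rep h.
Proof.
move=> gh; congr ClassicalEpsilon.epsilon; apply: functional_extensionality => l.
apply: propositional_extensionality; split=> lg; apply: indist_trans lg _ => //.
exact: indist_sym.
Qed.

Lemma indist_rep g h : indist (rep g) (rep h) -> rep g = rep h.
Proof.
move=> gh; apply: rep_eq; apply: indist_trans (rep_indist h).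
by apply: indist_trans gh; apply: indist_sym; apply: rep_indist.
Qed.

(** The finite sets of all members of [l] merge into one, still chosen before [k], as the rank
    radical demands. *)
Lemma rep_close (l : list G) : exists F, forall k, exists k',
  forall n (rho : G -> 'M[CC]_n), near_rep mul e F k' rho ->
  forall g, In g l -> (k * \rank (rho g - rho (rep g))%R <= n)%N.
Proof.
elim: l => [|g l [F IH]]; first by exists nil => k; exists 0%N.
have [F1 H1] := rep_indist g; exists (F1 ++ F) => k.
have [k1 {}H1] := H1 k; have [k2 {}IH] := IH k; exists (maxn k1 k2) => n rho nr.
have nr1 : near_rep mul e F1 k1 rho.
  by apply: near_rep_weaken nr; [apply: incl_appl; apply: incl_refl | exact: leq_maxl].
have nr2 : near_rep mul e F k2 rho.
  by apply: near_rep_weaken nr; [apply: incl_appr; apply: incl_refl | exact: leq_maxr].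
move=> g' [<-|lg]; last exact: IH.
by rewrite -mxrank_opp opprB; apply: H1.
Qed.

Definition map_rep (p : FS G) : FS G := List.map (fun cg => (cg.1, rep cg.2)) p.

Lemma lin_map_rep (V : lmodType CC) (f : G -> V) p : lin f (map_rep p) = lin (f \o rep) p.
Proof. by elim: p => [|cg p IH]; rewrite ?lin_nil // !lin_cons IH. Qed.

Lemma linB (V : lmodType CC) (f f' : G -> V) p :
  lin f p - lin f' p = lin (fun g => f g - f' g) p.
Proof. by rewrite /lin -sumrB; apply: eq_bigr => cg _; rewrite scalerBr. Qed.

Lemma mulmx_lin m n (Q : 'M[CC]_(m, n)) (P : 'M[CC]_(n, m)) (f : G -> 'M[CC]_n) p :
  Q *m lin f p *m P = lin (fun g => Q *m f g *m P) p.
Proof.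
rewrite /lin mulmx_sumr mulmx_suml; apply: eq_bigr => cg _.
by rewrite -scalemxAr -scalemxAl.
Qed.

Lemma coef_notin (g : G) x : ~ In g (supp x) -> coef G x g = C0.
Proof.
elim: x => [|cg x IH] //= xg.
case: excluded_middle_informative => [cgg|_]; first by case: xg; left.
by apply: IH => ?; apply: xg; right.
Qed.

(** [lin rho] vanishes on [map_rep p], so [psi p] is a combination of the differences
    [rho g - rho (rep g)] minus one of the [rho g - P g]. Each combination has relative rank at most
    [|p|/k], whence the choice [2|p| < delta k]. *)
Lemma map_rep0_RR (inv : G -> G) (p : FS G) : IsGroup G mul inv e ->
  has_afdr G mul e -> (forall g, coef G (map_rep p) g = C0) -> in_RR G mul e p.
Proof.
move=> HG afdr p0; right; split=> //.
have [F close] := rep_close (supp p).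
pose F' := F ++ supp p.
have pF : incl (supp p) (nbhd mul inv e F').
  by move=> g pg; apply: nbhd_incl; apply/in_app_iff; right.
exists (List.map (@single G) (nbhd mul inv e F')); split; last split.
- by apply: inL_In; apply: in_map; left.
- exact: inL_supp.
move=> delta d0; have [k dk] := INR_archimedean (INR (2 * length p)) d0.
have [k' close'] := close k; pose c := maxn k k'.
(* The successor keeps the inverse positive when [c = 0]; smaller [eps] still satisfy
   [4 c eps <= 1]. *)
have inv0 : Rlt R0 (Rinv (INR (4 * c).+1)) by apply: Rinv_0_lt_compat; apply: lt_0_INR; lia.
exists (Rinv (INR (4 * c).+1)); split=> // eps eps0 epsc n psi ar.
have [|rho [n0 nr rhoP psiE]] := almost_rep_near_rep (k := c) HG ar.
  have [i0 i1] := (pos_INR (4 * c)%N, Rinv_l (INR (4 * c).+1)).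
  have : INR (4 * c).+1 <> R0 by apply: not_0_INR.
  move=> /i1; rewrite S_INR in epsc inv0 *; nra.
exists (\rank (tomx n n (psi p))^T); split; first exact: dim_range_rank.
apply: leq_frac n0 _ dk; rewrite mxrank_tr psiE //.
set P := fun g => tomx n n _ in psiE *.
have nrk' : near_rep mul e F k' rho.
  by apply: near_rep_weaken nr; [apply: incl_appl; apply: incl_refl | exact: leq_maxr].
have r1 := mxrank_lin (f := fun g => rho g - rho (rep g)) (close' _ _ nrk').
have r2 : (k * \rank (lin (fun g => (rho g - P g)%R) p) <= length p * n)%N.
  apply: mxrank_lin => g pg; apply: leq_trans (rhoP g _); last by apply/in_app_iff; right.
  by rewrite leq_mul2r leq_maxl orbT.
have -> : lin P p = lin (fun g => rho g - rho (rep g)) p - lin (fun g => rho g - P g) p.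
  rewrite -!linB -[lin (fun g => rho (rep g)) p](lin_map_rep rho) (lin_eq0 _ p0).
  by rewrite subr0 opprB addrC subrK.
have := mxrank_add (lin (fun g => rho g - rho (rep g)) p) (- lin (fun g => rho g - P g) p).
rewrite mxrank_opp; move: r1 r2; move: (\rank _) (\rank _) (\rank _) (length p).
clear; nia.
Qed.

(** The value [delta = 1/(2S)], with [S = 4^|hs|], is fixed by [p] and [h0] before [B] is known.
    Whatever [B] is, some near representation gives [map_rep p] relative rank at least [1/S], and
    [p] differs from it by at most [1/(2S)]. *)
Lemma map_rep_neq0_SR (p : FS G) h0 : coef G (map_rep p) h0 <> C0 ->
  ~ (forall delta, Rlt R0 delta ->
   exists B : list (FS G), inL G B (fs_one G e) /\ inL G B p /\
     exists eta, Rlt R0 eta /\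
       forall eps, Rlt R0 eps -> Rlt eps eta ->
       forall (n : nat) (psi : FS G -> mat), almost_rep G mul e B eps n psi ->
         rank_lt n (psi p) delta).
Proof.
move=> h0p SR; set p' := map_rep p in h0p.
pose hs := supp (remove h0 p').
have In_rep h : In h (supp p') -> exists g, h = rep g.
  by rewrite /supp /p' /map_rep map_map => /in_map_iff[cg [<- _]]; exists cg.2.
(* Elements of the support of [p'] are representatives, so distinct ones are distinguishable. *)
have nind h : In h hs -> ~ indist h h0.
  move=> hhs gind; have [/In_rep[g hg] gh0] := In_supp_remove hhs.
  apply: gh0; rewrite hg in gind *.
  have [|g0 h0g0] := In_rep h0; first by apply: NNPP => /coef_notin.
  by rewrite h0g0 in gind *; apply: indist_rep.
pose S := (4 ^ length hs)%N.
have S0 : (0 < S)%N by rewrite expn_gt0.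
have S2 : Rlt R0 (INR (2 * S)) by apply: lt_0_INR; lia.
have [B [_ [_ [eta [eta0 Bp]]]]] := SR _ (Rinv_0_lt_compat _ S2).
have [F close] := rep_close (supp p).
(* Each of the [|p|] differences then has rank at most [N/(2|p|S)], hence their combination at most
   [N/(2S)]. *)
have [k' close'] := close (2 * length p * S)%N.
pose F' := F ++ flat_map (@supp G) B.
pose eps := (Rmult eta (Rinv (IZR 2))).
have eps0 : Rlt R0 eps by rewrite /eps; lra.
have [k0 k0P] := INR_archimedean (INR (length F' * length F')) eps0.
pose c := maxn k0 k'.
have [N [theta [s [Q [P [N0 nr Ns z u]]]]]] := separate_list F' c nind.
have kc : Rle (INR k0) (INR c) by apply: leq_INR; exact: leq_maxl.
have [||d [/rank_dim_range dr dN]] := Bp eps eps0 _ N (fun x => ofmx (lin theta x)).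
- by rewrite /eps; lra.
- apply: near_rep_almost_rep nr _ => //; last nra.
  by apply: incl_appr; apply: incl_refl.
rewrite ofmxK in dr.
have {}dN : (2 * S * d < N)%N.
  rewrite ltnNge; apply/negP => /leq_INR; rewrite INRM.
  move: dN => /(Rmult_lt_compat_l _ _ _ S2); rewrite -Rmult_assoc Rinv_r; lra.
have nrk' : near_rep mul e F k' theta.
  by apply: near_rep_weaken nr; [apply: incl_appl; apply: incl_refl | exact: leq_maxr].
have r1 := mxrank_lin (f := fun g => theta g - theta (rep g)) (close' _ _ nrk').
have r2 : (s <= \rank (lin theta p'))%N.
  apply: leq_trans (mxrankM_maxl _ P); apply: leq_trans (mxrankM_maxr Q _).
  rewrite mulmxA mulmx_lin (lin_remove _ h0) (eq_lin (f' := fun=> 0)).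
    rewrite [lin (fun=> 0) _]big1 => [|cg _]; last exact: scaler0.
    rewrite addr0 mxrank_scale_nz ?mxrank_unit //.
    by apply/eqP; rewrite -toCC0 => /toCC_inj.
  by move=> g /z.
have r3 : (\rank (lin theta p') <=
    \rank (lin theta p) + \rank (lin (fun g => (theta g - theta (rep g))%R) p))%N.
  have -> : lin theta p' = lin theta p - lin (fun g => theta g - theta (rep g)) p.
    by rewrite -linB lin_map_rep opprB addrC subrK.
  by rewrite -[X in (_ <= _ + X)%N]mxrank_opp mxrank_add.
have p1 : (0 < length p)%N.
  by rewrite lt0n; apply/eqP => /length_zero_iff_nil pn; apply: h0p; rewrite /p' pn.
move: r1 r2 r3 dr; move: (\rank _) (\rank _) (\rank _) => a b b' r1 r2 r3 dr.
have {}r1 : (2 * S * b' <= N)%N.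
  rewrite -(leq_pmul2l p1); apply: leq_trans r1; apply: eq_leq; lia.
clear - Ns r1 r2 r3 dr dN; rewrite -/S in Ns; nia.
Qed.

End Representatives.

Theorem mainTheorem19 (G : Type) (mul : G -> G -> G) (inv : G -> G) (e : G) :
  IsGroup G mul inv e -> countable G ->
  forall p : FS G, in_SR G mul e p <-> in_RR G mul e p.
Proof.
move=> HG _ p; split=> [|[?|[afdr [B [B1 [Bp H]]]]]]; [|by left|]; last first.
  (* A [B] valid for all [delta] serves for each one. *)
  by right; split=> // delta /H; exists B.
case=> [?|[afdr SR]]; first by left.
have [p0|] := classic (forall g, coef G (map_rep mul e p) g = C0).
  exact: map_rep0_RR HG afdr p0.
by move=> /not_all_ex_not[h0 h0p]; case: (map_rep_neq0_SR h0p SR).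
Qed.
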